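(* Let $t,n\ge1$, $p\ge t+2$, fix $g\in\{1,\ldots,n\}$ and a cluster $A_0$ of grading $(g-1,\ldots,g-1)$. Let $a,b,c\in\mathfrak{P}$ be pairwise distinct posts and fix $v\in\{1,\ldots,t\}$. Let $\mathbf{g}_v=(g_1,\ldots,g_t)$ with $g_v=g$ and $g_u=g-1$ for $u\ne v$, and let $A,B,C\subseteq A_0$ be the clusters of grading $\mathbf{g}_v$ contained in $A_0$ in which the disk $d_{v,g}$ occupies post $a$, $b$, $c$ respectively. Let $\alpha\in A$ be a configuration with $\rho^g_{b,c}(\alpha)=\alpha$, and let $\beta\in B$ be a configuration. Let $\nu$ be a valid configuration sequence from $\alpha$ to $\beta$ which is a concatenation $\nu=\nu_A+\nu_C+\nu_B$ of nonempty sequences $\nu_A,\nu_C,\nu_B$ whose configurations all lie in $A$, $C$, $B$ respectively. Then there exists a valid configuration sequence $\mu$ from $\alpha$ to $\beta$ which is a concatenation $\mu=\mu_A+\mu_B$ with all configurations of $\mu_A$ in $A$ and all configurations of $\mu_B$ in $B$, such that the transfer length of $\mu$ is strictly less than the transfer length of $\nu$.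
   Context: Setting (parallel Tower of Hanoi): there are $t$ towers (colors) of $n$ disks each and $p\ge t+2$ posts forming a set $\mathfrak{P}$. Disk $d_{u,j}$ ($u\in\{1,\ldots,t\}$, $j\in\{1,\ldots,n\}$) is the $j$-th largest disk of color $u$; smaller index means larger disk, and disks of the same index have equal size. A configuration is a $t\times n$ matrix $(a_{u,j})$ with entries in $\mathfrak{P}$, where $a_{u,j}$ is the post occupied by $d_{u,j}$, such that for each $j$ the entries $a_{1,j},\ldots,a_{t,j}$ are pairwise distinct (no disk on a smaller or equal-sized disk; disks on a post are stacked by size). Configurations $\alpha=(a_{u,j})$ and $\beta=(b_{u,j})$ are EREW-adjacent if (i) $a_{u,j}\ne b_{u,j}$ for at least one $(u,j)$, and (ii) whenever $a_{u,j}\ne b_{u,j}$, for all $w\in\{1,\ldots,t\}$ and all $y>j$ we have $a_{w,y}\ne a_{u,j}$ and $b_{w,y}\ne b_{u,j}$. A valid configuration sequence is a finite sequence $(\alpha_1,\ldots,\alpha_m)$ in which each consecutive pair is either equal or EREW-adjacent; ''$+$'' denotes concatenation of sequences. For configurations let $e(\alpha,\beta)$ be the number of disks $d_{u,j}$ with $a_{u,j}\ne b_{u,j}$; the transfer length of $(\alpha_1,\ldots,\alpha_m)$ is $\sum_{1\le i<m} e(\alpha_i,\alpha_{i+1})$. For $\mathbf{g}=(g_1,\ldots,g_t)\in\{0,\ldots,n\}^t$, a cluster of grading $\mathbf{g}$ is the set of all configurations in which, for each $u$, the disks $d_{u,1},\ldots,d_{u,g_u}$ occupy prescribed fixed posts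 (grading $(0,\ldots,0)$ gives all configurations). Reflective map: for $g\in\{1,\ldots,n\}$ and posts $q,r$, $\rho^g_{q,r}$ sends $(a_{u,y})$ to $(b_{u,y})$ where $b_{u,y}=a_{u,y}$ for $y<g$, and for $y\ge g$: $b_{u,y}=r$ if $a_{u,y}=q$, $b_{u,y}=q$ if $a_{u,y}=r$, and $b_{u,y}=a_{u,y}$ otherwise. *)

(* Defs.v *)
From mathcomp Require Import all_boot all_algebra.

Set Implicit Arguments.
Unset Strict Implicit.
Unset Printing Implicit Defensive.

(** Parallel Tower of Hanoi with [t] colors, [n] disks per color, posts [P].

    Colors and sizes are numbered from 0: for [u : 'I_t] and [j : 'I_n], the
    entry [M u j] of [M : 'M[P]_(t, n)] is the post occupied by the
    [j.+1]-th largest disk of color [u].  Gradings, being numbers of disks, are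
    not shifted. *)

Section ParallelHanoi.

Variables (P : finType) (t n : nat).
Implicit Types M N : 'M[P]_(t, n).

Definition configuration : {set 'M[P]_(t, n)} :=
  [set M : 'M[P]_(t, n) | [forall j, injectiveb (fun u => M u j)]].

Definition erew_adjacent : rel 'M[P]_(t, n) := fun M N =>
  [exists u, exists j, M u j != N u j] &&
  [forall u, forall j, (M u j != N u j) ==>
    [forall w, forall y : 'I_n, (j < y) ==>
      (M w y != M u j) && (N w y != N u j)]].

Definition valid_sequence (s : seq 'M[P]_(t, n)) : bool :=
  all (mem configuration) s &&
  sorted (fun M N => (M == N) || erew_adjacent M N) s.

Definition valid_sequence_from_to M N (s : seq 'M[P]_(t, n)) : bool :=
  [&& valid_sequence s, ohead s == Some M & last M s == N].

Definition moved_disks M N : nat :=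
  #|[set d : 'I_t * 'I_n | M d.1 d.2 != N d.1 d.2]|.

Definition transfer_length (s : seq 'M[P]_(t, n)) : nat :=
  if s is M :: s' then sumn (pairmap moved_disks M s') else 0.

(** [f u j] is the prescribed post of disk [(u, j)]; only its values at
    [j < gr u], i.e. for the [gr u] largest disks of color [u], matter. *)
Definition cluster (gr : 'I_t -> nat) (f : 'I_t -> 'I_n -> P) :
    {set 'M[P]_(t, n)} :=
  [set M : 'M[P]_(t, n) in configuration |
    [forall u, forall j : 'I_n, (j < gr u) ==> (M u j == f u j)]].

Definition is_cluster (gr : 'I_t -> nat) (A : {set 'M[P]_(t, n)}) : Prop :=
  (forall u, gr u <= n) /\ exists f, A = cluster gr f.

(** With 0-based [g], this is the reflective map of 1-based index [g.+1]: it
    fixes the [g] largest disks of each color. *)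
Definition reflective_map (g : 'I_n) (q r : P) M : 'M[P]_(t, n) :=
  \matrix_(u < t, y < n)
    if y < g then M u y
    else if M u y == q then r
    else if M u y == r then q
    else M u y.

End ParallelHanoi.

(* Main.v *)
(** Apply the reflection [rho] exchanging [b] and [c] to [nuA ++ nuC] and keep
    [nuB].  Since [alpha] is fixed by [rho], the new sequence still starts at
    [alpha], and [rho] carries [C] into [B].  At the junction, the old sequence
    moved disk [(v, g)] from [c] to [b], whereas now it already is on [b].
    Exclusivity of that old move leaves no other disk of index at least [g] on
    [c] before it or on [b] after it, so every disk that still moves at the
    junction was already moving there. *)

Require Import Defs.
From mathcomp Require Import all_boot all_fingroup all_algebra.

Section Reflection.

Set Implicit Arguments.
Unset Strict Implicit.

Variables (P : finType) (t n : nat).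
Implicit Types (M N : 'M[P]_(t, n)) (s : seq 'M[P]_(t, n)).

(** Convertible to the relation under which [valid_sequence] is sorted. *)
Definition hanoi_step : rel 'M[P]_(t, n) :=
  fun M N => (M == N) || erew_adjacent M N.

(** Equal configurations satisfy exclusivity vacuously, so allowing equality amounts to dropping the
    demand that some disk moves. *)
Lemma hanoi_stepP M N :
  reflect (forall u j w (y : 'I_n), M u j != N u j -> j < y ->
             (M w y != M u j) && (N w y != N u j))
          (hanoi_step M N).
Proof.
apply: (iffP idP) => [/orP[/eqP-> u j w y | /andP[_ H] u j w y Mj jy] |H].
- by rewrite eqxx.
- by move/forallP/(_ u)/forallP/(_ j): H; rewrite Mj /= => /forallP/(_ w)
    /forallP/(_ y); rewrite jy.
- rewrite /hanoi_step; case: eqVneq => //= neMN; apply/andP; split.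
  + apply/existsP; case: (boolP [exists u, exists j, M u j != N u j]).
      by move/existsP.
    rewrite negb_exists => /forallP E; case/eqP: neMN.
    apply/matrixP => u j; move: (E u); rewrite negb_exists => /forallP/(_ j).
    by rewrite negbK => /eqP.
  + apply/forallP => u; apply/forallP => j; apply/implyP => Mj.
    apply/forallP => w; apply/forallP => y; apply/implyP => jy.
    exact: H.
Qed.

Lemma configurationP M :
  reflect (forall j, injective (fun u => M u j)) (M \in configuration P t n).
Proof.
rewrite inE; apply: (iffP forallP) => H j; first exact/injectiveP.
exact/injectiveP.
Qed.

Lemma cluster_configuration gr (A : {set 'M[P]_(t, n)}) M :
  is_cluster gr A -> M \in A -> M \in configuration P t n.
Proof. by case=> _ [f ->]; rewrite inE => /andP[]. Qed.

Lemma cluster_agree gr (A : {set 'M[P]_(t, n)}) M N u (j : 'I_n) :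
  is_cluster gr A -> M \in A -> N \in A -> j < gr u -> M u j = N u j.
Proof.
case=> _ [f ->]; rewrite !inE => /andP[_ /forallP/(_ u)/forallP/(_ j) HM].
by move=> /andP[_ /forallP/(_ u)/forallP/(_ j) HN] jg;
  move: HM HN; rewrite jg => /eqP-> /eqP->.
Qed.

(** A known member stands in for the prescribed posts [f]; this is how reflected configurations are
    placed in [A] or [B]. *)
Lemma cluster_mem gr (A : {set 'M[P]_(t, n)}) M N :
  is_cluster gr A -> M \in A -> N \in configuration P t n ->
  (forall u (j : 'I_n), j < gr u -> N u j = M u j) -> N \in A.
Proof.
case=> _ [f ->]; rewrite [M \in _]inE => /andP[_ /forallP HM] cN E.
rewrite inE cN; apply/forallP => u; apply/forallP => j; apply/implyP => jg.
by rewrite E //; move/forallP/(_ j): (HM u); rewrite jg.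
Qed.

(** Isolates the cost of the junction of two nonempty blocks, the only term that the reflection will
    change. *)
Lemma transfer_length_cat M s N s' :
  transfer_length ((M :: s) ++ N :: s') =
  transfer_length (M :: s) + moved_disks (last M s) N
  + transfer_length (N :: s').
Proof. by rewrite /= pairmap_cat sumn_cat /= addnA. Qed.

Variables (g : 'I_n) (q r : P).
Local Notation rho := (reflective_map g q r).

(** As a transposition the swap is a permutation, so its injectivity comes from [perm_inj]. *)
Lemma reflective_mapE M u (y : 'I_n) :
  rho M u y = if y < g then M u y else tperm q r (M u y).
Proof.
rewrite mxE; case: ifP => // _.
by case: tpermP => [->|->|/eqP/negPf-> /eqP/negPf->] //; rewrite eqxx //;
  case: eqP.
Qed.

Lemma reflective_map_lt M u (y : 'I_n) : y < g -> rho M u y = M u y.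
Proof. by rewrite reflective_mapE => ->. Qed.

Lemma reflective_map_ge M u (y : 'I_n) :
  g <= y -> rho M u y = tperm q r (M u y).
Proof. by rewrite reflective_mapE ltnNge => ->. Qed.

Lemma reflective_map_eq M N u w (y : 'I_n) :
  (rho M u y == rho N w y) = (M u y == N w y).
Proof. by rewrite !reflective_mapE; case: ifP => // _; exact: inj_eq perm_inj _ _. Qed.

Lemma reflective_map_configuration M :
  M \in configuration P t n -> rho M \in configuration P t n.
Proof.
move=> /configurationP cM; apply/configurationP => j u w /eqP.
by rewrite reflective_map_eq => /eqP/cM.
Qed.

(** A moving disk has index at least [g], hence so do the smaller disks it is compared with. All
    their posts undergo the same injective transposition, which preserves the inequalities. *)
Lemma reflective_map_step M N :
  (forall u (j : 'I_n), j < g -> M u j = N u j) ->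
  hanoi_step M N -> hanoi_step (rho M) (rho N).
Proof.
move=> E /hanoi_stepP H; apply/hanoi_stepP => u j w y.
rewrite reflective_map_eq => Mj jy.
have gj : g <= j by rewrite leqNgt; apply: contra Mj => /E ->.
have gy := leq_trans gj (ltnW jy).
by rewrite !reflective_map_ge // !(inj_eq perm_inj) H.
Qed.

Lemma moved_disks_reflective_map M N :
  moved_disks (rho M) (rho N) = moved_disks M N.
Proof. by apply: eq_card => d; rewrite !inE reflective_map_eq. Qed.

Lemma transfer_length_reflective_map s :
  transfer_length (map rho s) = transfer_length s.
Proof.
case: s => //= M s; elim: s M => //= N s IHs M.
by rewrite moved_disks_reflective_map IHs.
Qed.

Lemma sorted_reflective_map (A : {set 'M[P]_(t, n)}) s :
  is_cluster (fun _ => g : nat) A -> {subset s <= A} ->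
  sorted hanoi_step s -> sorted hanoi_step (map rho s).
Proof.
move=> hA /allP sA; rewrite sorted_map; apply: sub_in_sorted sA => M N MA NA.
by apply: reflective_map_step => u j; exact: (cluster_agree hA).
Qed.

Section Junction.

Variables (v : 'I_t) (M N : 'M[P]_(t, n)).
Hypotheses (cM : M \in configuration P t n) (cN : N \in configuration P t n).
Hypotheses (qr : q != r) (Mvg : M v g = r) (Nvg : N v g = q).
Hypotheses (E : forall u (j : 'I_n), j < g -> M u j = N u j).
Hypothesis stepMN : hanoi_step M N.

Lemma junction_moved u j :
  rho M u j != N u j -> (M u j != N u j) && ((u, j) != (v, g)).
Proof.
have movg : M v g != N v g by rewrite Mvg Nvg eq_sym.
case: (eqVneq (u, j) (v, g)) => [[-> ->] | ne].
  by rewrite reflective_map_ge // Mvg tpermR Nvg eqxx.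
rewrite andbT; case: (ltngtP j g) => [jg|gj|/val_inj jg].
- by rewrite reflective_map_lt.
(* Exclusivity of the move of [(v, g)] gives [M u j != r] and [N u j != q]. The transposition then
   matters only if [M u j] is [q], and such a disk moved already. *)
- have /andP[] := hanoi_stepP _ _ stepMN v g u j movg gj.
  rewrite Mvg Nvg reflective_map_ge ?(ltnW gj) // => Mr Nq.
  by case: tpermP => [-> _|Mr' | //]; [rewrite eq_sym | rewrite Mr' eqxx in Mr].
(* Exclusivity is silent about disks of equal size; here injectivity of the columns of [M] and [N]
   keeps other colors off [r] and [q] respectively. *)
- subst j; have uv : u != v by apply: contraNneq ne => ->.
  rewrite reflective_map_ge //; case: tpermP => [-> _|Mr|//].
    rewrite eq_sym -Nvg; apply: contra uv => /eqP.
    by move/configurationP: cN => /[apply] ->.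
  by case/eqP: uv; apply: (configurationP _ cM g); rewrite /= Mr.
Qed.

(** Every disk moving here also moved from [M] to [N]. The condition at [N] is unchanged, and the
    one at [rho M] compares two posts reflected by the same transposition. *)
Lemma junction_step : hanoi_step (rho M) N.
Proof.
apply/hanoi_stepP => u j w y /junction_moved/andP[Mj _] jy.
have /andP[Mw ->] := hanoi_stepP _ _ stepMN u j w y Mj jy.
have gj : g <= j by rewrite leqNgt; apply: contra Mj => /E ->.
by rewrite !reflective_map_ge ?(leq_trans gj (ltnW jy)) // (inj_eq perm_inj) Mw.
Qed.

Lemma junction_moved_disks : moved_disks (rho M) N < moved_disks M N.
Proof.
apply: proper_card; apply/properP; split.
  by apply/subsetP => -[u j]; rewrite !inE => /junction_moved/andP[].
exists (v, g); rewrite inE /= ?Mvg ?Nvg 1?eq_sym //.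
by rewrite reflective_map_ge // Mvg tpermR eqxx.
Qed.

End Junction.

End Reflection.

Theorem theorem2 (P : finType) (t n : nat) (ht : 1 <= t) (hn : 1 <= n)
    (hp : t + 2 <= #|P|)
    (g : 'I_n) (* 0-based; as a number of disks, [g] is the 1-based index minus 1 *)
    (A0 : {set 'M[P]_(t, n)}) (hA0 : is_cluster (fun _ => g : nat) A0)
    (a b c : P) (hab : a <> b) (hac : a <> c) (hbc : b <> c)
    (v : 'I_t)
    (A B C : {set 'M[P]_(t, n)})
    (hA : is_cluster (fun u => if u == v then g.+1 else g) A)
    (hAA0 : A \subset A0) (hAa : forall M, M \in A -> M v g = a)
    (hB : is_cluster (fun u => if u == v then g.+1 else g) B)
    (hBA0 : B \subset A0) (hBb : forall M, M \in B -> M v g = b)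
    (hC : is_cluster (fun u => if u == v then g.+1 else g) C)
    (hCA0 : C \subset A0) (hCc : forall M, M \in C -> M v g = c)
    (alpha : 'M[P]_(t, n)) (halpha : alpha \in A)
    (hrefl : reflective_map g b c alpha = alpha)
    (beta : 'M[P]_(t, n)) (hbeta : beta \in B)
    (nuA nuC nuB : seq 'M[P]_(t, n))
    (hnuA0 : nuA <> [::]) (hnuC0 : nuC <> [::]) (hnuB0 : nuB <> [::])
    (hnuA : forall M, M \in nuA -> M \in A)
    (hnuC : forall M, M \in nuC -> M \in C)
    (hnuB : forall M, M \in nuB -> M \in B)
    (hnu : valid_sequence_from_to alpha beta (nuA ++ nuC ++ nuB)) :
  exists muA muB : seq 'M[P]_(t, n),
    [/\ valid_sequence_from_to alpha beta (muA ++ muB),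
        (forall M, M \in muA -> M \in A),
        (forall M, M \in muB -> M \in B) &
        transfer_length (muA ++ muB) < transfer_length (nuA ++ nuC ++ nuB)].
Proof.
have neq_bc : b != c by apply/eqP.
have AA0 M : M \in A -> M \in A0 by move/(subsetP hAA0).
have BA0 M : M \in B -> M \in A0 by move/(subsetP hBA0).
have CA0 M : M \in C -> M \in A0 by move/(subsetP hCA0).
have A0conf M : M \in A0 -> M \in configuration P t n.
  exact: cluster_configuration hA0.
(* Beyond what [A0] fixes, [D] prescribes only the post of [(v, g)], so only that post has to be
   checked after reflection. *)
have rho_mem (D : {set 'M[P]_(t, n)}) M N :
    is_cluster (fun u => if u == v then g.+1 else g) D ->
    M \in D -> M \in A0 -> N \in A0 -> tperm b c (N v g) = M v g ->
    reflective_map g b c N \in D.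
  move=> hD MD MA0 NA0 Nvg; apply: (cluster_mem hD MD).
    exact/reflective_map_configuration/A0conf.
  move=> u j; case: (ltngtP j g) => [jg _|gj|/val_inj->].
  - by rewrite reflective_map_lt //; apply: (cluster_agree hA0).
  - by case: ifP => _; rewrite ?ltnS leqNgt ?gj // ltnW.
  - by case: eqP => [->|_]; rewrite ?ltnn // reflective_map_ge.
have rhoA M : M \in nuA -> reflective_map g b c M \in A.
  move=> /hnuA MA; apply: (rho_mem _ M) => //; try exact: AA0.
  by rewrite hAa // tpermD //; apply/eqP => e; [apply: hab|apply: hac].
(* [beta] serves as the reference member of [B]. *)
have rhoC M : M \in nuC -> reflective_map g b c M \in B.
  move=> /hnuC MC; apply: (rho_mem _ beta) => //; [exact: BA0|exact: CA0|].
  by rewrite hCc // tpermR hBb.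
case: nuA hnuA0 hnuA hnu rhoA => // M0 sA _ {}hnuA hnu rhoA.
case: nuB hnuB0 hnuB hnu => // N sB _ {}hnuB hnu.
have sA0 : {subset (M0 :: sA) ++ nuC <= A0}.
  by move=> M; rewrite mem_cat => /orP[/hnuA/AA0|/hnuC/CA0].
(* Nonemptiness of [nuC] puts the configuration just before [nuB] in [C], with [(v, g)] on [c]. *)
have lastC : last M0 (sA ++ nuC) \in nuC.
  by case: nuC hnuC0 {hnuC hnu rhoC sA0} => // M s _; rewrite last_cat /= mem_last.
set L := last M0 (sA ++ nuC) in lastC.
have LC := hnuC _ lastC; have NB : N \in B by apply: hnuB; rewrite mem_head.
have [LA0 NA0] := (CA0 _ LC, BA0 _ NB).
move: hnu; rewrite catA => /and3P[/andP[_ srt] /eqP[M0E] lastE].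
have [srt1 stepLN srt2] : [/\ sorted (@hanoi_step P t n) (M0 :: sA ++ nuC),
    hanoi_step L N & sorted (@hanoi_step P t n) (N :: sB)].
  by move: srt; rewrite /= cat_path /= => /and3P[].
have agree u (j : 'I_n) : j < g -> L u j = N u j.
  exact: (cluster_agree hA0).
have cL := A0conf _ LA0; have cN := A0conf _ NA0.
have [Lvg Nvg] := (hCc _ LC, hBb _ NB).
pose rho := @reflective_map P t n g b c.
exists (map rho (M0 :: sA)), (map rho nuC ++ N :: sB); split.
- rewrite catA -map_cat; apply/and3P; split.
  + apply/andP; split.
      rewrite all_cat all_map; apply/andP; split; apply/allP => M Ms /=.
        exact/reflective_map_configuration/A0conf/sA0.
      exact/A0conf/BA0/hnuB.
    have /= := sorted_reflective_map b c hA0 sA0 srt1.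
    rewrite cat_path /= -/rho => ->; rewrite last_map -/L /=.
    by apply/andP; split=> //; exact: (@junction_step _ _ _ _ _ _ v).
  + by rewrite /= M0E /rho hrefl.
  + by move: lastE; rewrite /= !last_cat.
- by move=> M /mapP[M' /rhoA ? ->].
- by move=> M; rewrite mem_cat => /orP[/mapP[M' /rhoC ? ->]|/hnuB].
(* Both sequences are cut just before [N]: the blocks on either side cost the same, so the junction
   terms decide. *)
- rewrite !catA -map_cat cat_cons map_cons !transfer_length_cat.
  rewrite -map_cons transfer_length_reflective_map last_map ltn_add2r ltn_add2l.
  exact: (@junction_moved_disks _ _ _ _ _ _ v).
Qed.
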